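(* Let $\mathcal M$ be an MR-algebra. Then there is an isomorphism of groups $$\operatorname{Inn}(\mathcal M)\simeq\operatorname{Inn}(\mathscr I(\mathscr C(\mathcal M))).$$
   Context: A cubic implication algebra is a join semilattice $\mathcal L$ with greatest element $\mathbf 1$ and a binary operation $\Delta$ (only values $\Delta(y,x)$ with $x\le y$ are used, so $\Delta$ may be regarded as a partial operation defined for such pairs) satisfying: (a) if $x\le y$ then $\Delta(y,x)\vee x=y$; (b) if $x\le y\le z$ then $\Delta(z,\Delta(y,x))=\Delta(\Delta(z,y),\Delta(z,x))$; (c) if $x\le y$ then $\Delta(y,\Delta(y,x))=x$; (d) if $x\le y\le z$ then $\Delta(z,x)\le\Delta(z,y)$; and, writing $x\to y=\Delta(\mathbf 1,\Delta(x\vee y,y))\vee y$, (e) $(x\to y)\to y=x\vee y$; (f) $x\to(y\to z)=y\to(x\to z)$. An MR-algebra is a cubic implication algebra such that whenever $a,b<x$: $\Delta(x,a)\vee b<x$ if and only if the meet $a\wedge b$ does not exist. Homomorphisms of cubic implication algebras preserve $\vee$, $\mathbf 1$ and $\Delta$; $\operatorname{Aut}(\mathcal L)$ is the automorphism group. An implication algebra is an algebra with one binary operation $\to$ satisfying $(x\to y)\to x=x$, $(x\to y)\to y=(y\to x)\to x$, $x\to(y\to z)=y\to(x\to z)$; it has a constant $1=x\to x$, is ordered by $x\le y$ iff $x\to y=1$, and is a join semilattice with $x\vee y=(x\to y)\to y$. The functor $\mathscr C$: for $a,b$ in a cubic implication algebra $\mathcal L$, put $a\sim b$ iff $\Delta(a\vee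 b,a)=b$. This is an equivalence relation; $[x]$ denotes the class of $x$, and $\mathscr C(\mathcal L)=\mathcal L/{\sim}$. It is an implication algebra with order $[x]\le[y]$ iff $\Delta(x\vee y,x)\le y$, top $[\mathbf 1]$, join $[x]\vee[y]=[x\vee\Delta(x\vee y,y)]$ and implication $[x]\to[y]=[(y\vee\Delta(x\vee y,x))\to y]$. If $\mathcal L$ is an MR-algebra, $\mathscr C(\mathcal L)$ is a lattice with $[x]\wedge[y]=[x\wedge\Delta(x\vee y,y)]$. For a cubic homomorphism $\phi$, $\mathscr C(\phi)([x])=[\phi(x)]$. The construction $\mathscr I$: for an implication algebra $\mathcal I$, $\mathscr I(\mathcal I)=\{\langle a,b\rangle : a,b\in\mathcal I,\ a\vee b=1,\ a\wedge b\text{ exists}\}$, ordered componentwise, with $\langle a,b\rangle\vee\langle c,d\rangle=\langle a\vee c,b\vee d\rangle$, $\mathbf 1=\langle 1,1\rangle$, and for $\langle c,d\rangle\le\langle a,b\rangle$, $\Delta(\langle a,b\rangle,\langle c,d\rangle)=\langle a\wedge(b\to d),\,b\wedge(a\to c)\rangle$. It is a cubic implication algebra, and an MR-algebra iff $\mathcal I$ is a lattice (in which case it is called a filter algebra). In particular $\mathscr I(\mathscr C(\mathcal M))$ is an MR-algebra for every MR-algebra $\mathcal M$. Inner automorphisms: for an MR-algebra $\mathcal M$, $\operatorname{Inn}(\mathcal M)$ is the kernel of the group homomorphism $\operatorname{Aut}(\mathcal M)\to\operatorname{Aut}(\mathscr C(\mathcal M))$, $\phi\mapsto\mathscr C(\phi)$;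 i.e. the group of automorphisms $\phi$ with $\phi(x)\sim x$ for all $x$. *)

(* Defs.v *)
From HB Require Import structures.
From mathcomp Require Import all_boot all_order.
From mathcomp Require Import boolp classical_sets.

Set Implicit Arguments.
Unset Strict Implicit.
Unset Printing Implicit Defensive.

Import Order.TTheory.

Local Open Scope order_scope.
Local Open Scope quotient_scope.

(* Meets in a poset, where they need not exist; [meet_or_top] is the meet when
   it exists and the irrelevant value [\top] otherwise. *)
Definition is_meet d (P : porderType d) (a b m : P) : Prop :=
  [/\ m <= a, m <= b & forall c, c <= a -> c <= b -> c <= m].

Definition meet_exists d (P : porderType d) (a b : P) : Prop :=
  exists m, is_meet a b m.

Definition meet_or_top d (P : tPOrderType d) (a b : P) : P :=
  xget \top [set m | is_meet a b m]%classic.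

(* [x -> y], as a function of the operation [delta] so that it can be used in
   the axioms below. *)
Definition cubic_imp d (L : tJoinSemilatticeType d) (delta : L -> L -> L)
    (x y : L) : L :=
  delta \top (delta (x `|` y) y) `|` y.

(* [delta] is a total function, but every axiom (and every notion below) only
   uses the values [delta y x] with [x <= y]. *)
HB.mixin Record isCubicImplicationAlgebra d L of Order.TJoinSemilattice d L := {
  delta : L -> L -> L;
  deltaU : forall x y : L, x <= y -> delta y x `|` x = y;
  delta_delta : forall x y z : L, x <= y -> y <= z ->
    delta z (delta y x) = delta (delta z y) (delta z x);
  deltaK : forall x y : L, x <= y -> delta y (delta y x) = x;
  delta_le : forall x y z : L, x <= y -> y <= z -> delta z x <= delta z y;
  cubic_impU : forall x y : L,
    cubic_imp delta (cubic_imp delta x y) y = x `|` y;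
  cubic_impCA : forall x y z : L,
    cubic_imp delta x (cubic_imp delta y z) =
    cubic_imp delta y (cubic_imp delta x z);
}.

#[short(type="cubicImplicationAlgebraType")]
HB.structure Definition CubicImplicationAlgebra d :=
  { L of isCubicImplicationAlgebra d L & Order.TJoinSemilattice d L }.

Arguments deltaU {d s x y} : rename.
Arguments delta_delta {d s x y z} : rename.
Arguments deltaK {d s x y} : rename.
Arguments delta_le {d s x y z} : rename.

HB.mixin Record CubicImplicationAlgebra_isMR d L
    of CubicImplicationAlgebra d L := {
  mr_axiom : forall a b x : L, a < x -> b < x ->
    (delta x a `|` b < x) <-> ~ meet_exists a b;
}.

#[short(type="mrAlgebraType")]
HB.structure Definition MRAlgebra d :=
  { L of CubicImplicationAlgebra_isMR d L & CubicImplicationAlgebra d L }.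

(* The order is determined by [imp] through [le_imp], hence so are the
   top [1 = x -> x] and the join [(x -> y) -> y], see [impxx] and [joinEimp]. *)
HB.mixin Record isImplicationAlgebra d I of Order.TJoinSemilattice d I := {
  imp : I -> I -> I;
  impK : forall x y : I, imp (imp x y) x = x;
  impC : forall x y : I, imp (imp x y) y = imp (imp y x) x;
  impCA : forall x y z : I, imp x (imp y z) = imp y (imp x z);
  le_imp : forall x y : I, (x <= y) = (imp x y == \top);
}.

#[short(type="implicationAlgebraType")]
HB.structure Definition ImplicationAlgebra d :=
  { I of isImplicationAlgebra d I & Order.TJoinSemilattice d I }.

Arguments mr_axiom {d s a b x} : rename.

(* Two-valued homomorphisms separate the points of an implication algebra. *)
Section Separation.
Variables (T : Type) (i : T -> T -> T) (one : T).
Hypothesis iK : forall x y, i (i x y) x = x.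
Hypothesis iC : forall x y, i (i x y) y = i (i y x) x.
Hypothesis iCA : forall x y z, i x (i y z) = i y (i x z).
Hypothesis ixx : forall x, i x x = one.

Definition imp_hom (h : T -> bool) := forall x y, h (i x y) = (h x ==> h y).

Let i1x x : i one x = x. Proof. by rewrite -(ixx x) iK. Qed.
Let ix1 x : i x one = one.
Proof. by have := iK one x; rewrite i1x. Qed.
Let iw x y : i y (i x y) = one. Proof. by rewrite iCA ixx ix1. Qed.
Let iB x y z : i (i y z) (i (i x y) (i x z)) = one.
Proof. by rewrite iCA (iCA _ x) iC (iCA x) iw. Qed.
Let ianti p q : i p q = one -> i q p = one -> p = q.
Proof. by move=> pq qp; rewrite -[p]i1x -qp iC pq i1x. Qed.
Let icontr x w : i x (i x w) = i x w.
Proof.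
apply: ianti; last exact: iw.
by rewrite iC iK ixx.
Qed.

Let filt (F : set T) :=
  F one /\ forall x y, F x -> F (i x y) -> F y.

Lemma imp_separation a b : i a b <> one ->
  exists2 h, imp_hom h & h a && ~~ h b.
Proof.
move=> ab.
pose P (F : set T) := F = set0 \/ [/\ filt F, F a & ~ F b].
have filt_ext x F : filt F -> filt [set z | F (i x z)]%classic.
  move=> [F1 FM]; split=> [|y z /= xy xyz]; first by rewrite /= ix1.
  rewrite -icontr; apply: (FM _ _ xy); apply: (FM _ _ xyz).
  by rewrite (iCA x y z) iB.
have mp : filt [set z | i a z = one]%classic.
  have := @filt_ext a [set one]%classic; apply.
  by split=> [//|x y /= ->]; rewrite i1x.
have [F [PF Fmax]] : exists F, P F /\ forall G, (F `<` G)%classic -> ~ P G.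
  apply: Zorn_bigcup => C CP Ct.
  have [C0|/existsNP[X /not_implyP[CX X0]]] :=
      pselect (forall X, C X -> X = set0).
    by left; rewrite -subset0 => x [X /C0 -> ].
  right; have [//|[[X1 XM] Xa Xb]] := CP _ CX.
  split; last 1 first.
  - by move=> [Y CY Yb]; have [Y0|[]//] := CP _ CY; rewrite Y0 in Yb.
  - split; first by exists X.
    move=> x y [Y CY Yx] [Z CZ Zxy].
    have [YZ|ZY] := Ct _ _ CY CZ.
      have [Z0|[[_ ZM] _ _]] := CP _ CZ; first by rewrite Z0 in Zxy.
      by exists Z => //; apply: ZM Zxy; exact: YZ.
    have [Y0|[[_ YM] _ _]] := CP _ CY; first by rewrite Y0 in Yx.
    by exists Y => //; apply: YM Yx _; exact: ZY.
  - by exists X.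
have {PF} [[F1 FM] Fa Fb] : [/\ filt F, F a & ~ F b].
  case: PF => [F0|//]; exfalso.
  apply: (Fmax [set z | i a z = one]%classic).
    rewrite F0; split; first by move=> x [].
    by move=> /(_ one); apply; exact: ix1.
  by right; split => //; exact: ixx.
have Fprime x : ~ F x -> F (i x b).
  move=> Fx; apply: contrapT => Fxb.
  have FG y : F y -> F (i x y) by move=> Fy; apply: (FM _ _ Fy); rewrite iw.
  apply: (Fmax [set z | F (i x z)]%classic).
    split; first exact: FG.
    by move=> /(_ x) /=; rewrite ixx => /(_ F1).
  by right; split; [exact: filt_ext | exact: FG |].
exists (fun x => `[< F x >]); last first.
  by apply/andP; split; [exact/asboolP | apply/asboolPn].
move=> x y; apply/idP/idP.
  by move=> /asboolP xy; apply/implyP => /asboolP Fx; apply/asboolP; exact: (FM _ _ Fx).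
move=> /implyP xy; apply/asboolP.
have [Fx|nFx] := pselect (F x).
  by apply: (FM _ _ (asboolW (xy (asboolT Fx)))); rewrite iw.
apply: contrapT => nFxy; apply: Fb.
have Fxb := Fprime _ nFx; have Fpb := Fprime _ nFxy.
apply: (FM _ _ Fxb); apply: (FM _ _ Fpb).
by rewrite (iC x b); have := iB (i x y) b x; rewrite iK iCA => ->.
Qed.

End Separation.

Section ImplicationTheory.
Context d (I : implicationAlgebraType d).
Implicit Types x y z a b m : I.

Lemma impxx x : imp x x = \top.
Proof. by apply/eqP; rewrite -le_imp. Qed.

Definition point (h : I -> bool) := imp_hom (@imp d I) h.

Lemma leP_point x y : (forall h, point h -> h x -> h y) <-> x <= y.
Proof.
rewrite le_imp; split=> [H|/eqP xy h hh]; last first.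
  by have := hh x y; rewrite xy -(impxx x) hh implybb => /esym/implyP.
apply: contrapT => /negP/eqP xy.
have [h hh /andP[hx]] := imp_separation impK impC impCA impxx xy.
by rewrite (H h).
Qed.

Lemma eqP_point x y : (forall h, point h -> h x = h y) <-> x = y.
Proof.
split=> [H|->//]; apply/le_anti/andP.
by split; apply/leP_point => h /H ->.
Qed.

Lemma point1 h : point h -> h \top.
Proof. by move=> hh; rewrite -(impxx \top) hh implybb. Qed.

Lemma joinEimp x y : x `|` y = imp (imp x y) y.
Proof.
apply/le_anti/andP; split.
  by rewrite leUx; apply/andP; split; apply/leP_point => h hh;
    rewrite !hh; case: (h x); case: (h y).
apply/leP_point => h hh; rewrite !hh.
have /leP_point/(_ _ hh)/implyP := leUl x y.
have /leP_point/(_ _ hh)/implyP := leUr y x.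
by case: (h x); case: (h y); case: (h (x `|` y)).
Qed.

Lemma pointU h x y : point h -> h (x `|` y) = h x || h y.
Proof. by move=> hh; rewrite joinEimp !hh; case: (h x); case: (h y). Qed.

Lemma lower_bound_meet x y m : m <= x -> m <= y ->
  is_meet x y (imp (imp x (imp y m)) m).
Proof.
move=> /leP_point mx /leP_point my.
split; first 2 last.
- move=> c /leP_point cx /leP_point cy; apply/leP_point => h hh.
  rewrite !hh => hc; rewrite (cx _ hh hc) (cy _ hh hc) /=.
  by case: (h m).
- apply/leP_point => h hh; have /implyP := mx _ hh; have /implyP := my _ hh.
  by rewrite !hh; case: (h x); case: (h y); case: (h m).
- apply/leP_point => h hh; have /implyP := mx _ hh; have /implyP := my _ hh.
  by rewrite !hh; case: (h x); case: (h y); case: (h m).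
Qed.

Lemma is_meet_unique x y m n : is_meet x y m -> is_meet x y n -> m = n.
Proof.
move=> [mx my Hm] [nx ny Hn]; apply/le_anti/andP.
by split; [exact: Hn | exact: Hm].
Qed.

Lemma lower_bound_exists x y m : m <= x -> m <= y -> meet_exists x y.
Proof.
move=> mx my; exists (imp (imp x (imp y m)) m).
exact: lower_bound_meet.
Qed.

Lemma meet_or_topP x y : meet_exists x y -> is_meet x y (meet_or_top x y).
Proof. exact: xgetPex. Qed.

Lemma pointI h x y : meet_exists x y -> point h ->
  h (meet_or_top x y) = h x && h y.
Proof.
move=> xy hh; have M := meet_or_topP xy; have [mx my _] := M.
rewrite (is_meet_unique M (lower_bound_meet mx my)) !hh.
move: mx my => /leP_point/(_ _ hh)/implyP + /leP_point/(_ _ hh)/implyP.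
by case: (h x); case: (h y); case: (h (meet_or_top x y)).
Qed.

End ImplicationTheory.

Section CubicTheory.
Context d (L : cubicImplicationAlgebraType d).
Implicit Types x y z : L.

Local Notation cimp := (cubic_imp (@delta d L)).

Lemma delta_leL x y : x <= y -> delta y x <= y.
Proof. by move=> xy; rewrite -[leRHS](deltaU xy) leUl. Qed.

Lemma deltaxx x : delta x x = x.
Proof.
apply/le_anti; rewrite delta_leL //=.
rewrite -{1}(deltaK (lexx x)); apply: delta_le => //; exact: delta_leL.
Qed.

Let cimp1x x : cimp \top x = x.
Proof. by rewrite /cubic_imp join1x deltaK ?lex1 // joinxx. Qed.

Lemma cubic_impxx x : cimp x x = \top.
Proof. by rewrite -{1}(cimp1x x) cubic_impU join1x. Qed.

Let cimpx1 x : cimp x \top = \top.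
Proof. by rewrite /cubic_imp joinx1. Qed.

Lemma cubic_impK x y : cimp (cimp x y) x = x.
Proof.
set q := cimp x y; set u := cimp q x.
have xq1 : q `|` x = \top.
  apply/eqP; rewrite eq_le lex1 /= -(deltaU (lex1 (delta (x `|` y) y))).
  rewrite leUx /q /cubic_imp; apply/andP; split.
    by rewrite -joinA leUl.
  apply: (le_trans (delta_leL (leUr y x))).
  by rewrite leUx leUr /= -joinA lexU2 // leUl orbT.
have xu : cimp x u = \top by rewrite cubic_impCA cubic_impxx cimpx1.
have ux : cimp u x = \top by rewrite /u cubic_impU.
have : cimp (cimp x u) u = cimp (cimp u x) x by rewrite !cubic_impU joinC.
by rewrite xu ux !cimp1x.
Qed.

Lemma cubic_impC x y : cimp (cimp x y) y = cimp (cimp y x) x.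
Proof. by rewrite !cubic_impU joinC. Qed.

Lemma le_cubic_imp x y : (x <= y) = (cimp x y == \top).
Proof.
apply/idP/eqP => [xy|xy]; last first.
  by rewrite leEjoin -cubic_impU xy cimp1x.
by rewrite -(cubic_impxx y) /cubic_imp (join_r xy) joinxx.
Qed.

End CubicTheory.

(* The implication algebra [(L, ->)], on a synonym of the carrier. *)
Definition cubic_implication d (L : cubicImplicationAlgebraType d) : Type := L.

Section CubicPoints.
Context d (L : cubicImplicationAlgebraType d).

HB.instance Definition _ := Order.TJoinSemilattice.on (cubic_implication L).
HB.instance Definition _ := isImplicationAlgebra.Build d (cubic_implication L)
  (@cubic_impK d L) (@cubic_impC d L) (@cubic_impCA d L) (@le_cubic_imp d L).

Implicit Types (x y z : L) (h : L -> bool).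

Definition cubic_point h := @point d (cubic_implication L) h.

Lemma cubic_leP x y : (forall h, cubic_point h -> h x -> h y) <-> x <= y.
Proof. exact: (@leP_point d (cubic_implication L)). Qed.

Lemma cubic_eqP x y : (forall h, cubic_point h -> h x = h y) <-> x = y.
Proof. exact: (@eqP_point d (cubic_implication L)). Qed.

Lemma cubic_pointU h x y : cubic_point h -> h (x `|` y) = h x || h y.
Proof. exact: (@pointU d (cubic_implication L)). Qed.

Lemma cubic_point1 h : cubic_point h -> h \top.
Proof. exact: (@point1 d (cubic_implication L)). Qed.

Local Notation "x ^" := (delta \top x) (at level 2, format "x ^").

Lemma hatK x : x^^ = x. Proof. by rewrite deltaK ?lex1. Qed.

Lemma hat_le x y : (x^ <= y^) = (x <= y).
Proof.
apply/idP/idP => [xy|xy]; last exact: delta_le (lex1 y).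
by rewrite -(hatK x) -(hatK y); apply: delta_le (lex1 _).
Qed.

Lemma hatU x y : (x `|` y)^ = x^ `|` y^.
Proof.
apply/le_anti; rewrite leUx !hat_le leUl leUr /= andbT.
by rewrite -hat_le hatK leUx -[X in X <= _]hatK -[X in _ && (X <= _)]hatK
  !hat_le leUl leUr.
Qed.

Lemma hat_delta x y : x <= y -> (delta y x)^ = delta y^ x^.
Proof. by move=> xy; rewrite delta_delta ?lex1. Qed.

Lemma cubic_cover h x : cubic_point h -> h x || h x^.
Proof.
by move=> hh; rewrite orbC -cubic_pointU // deltaU ?lex1 // cubic_point1.
Qed.

(* A point [h] reads every [x] as the sign [(h x, h x^)], one of [(1,0)],
   [(0,1)] and [(1,1)], and [delta y x] flips the signs of [x] where [y] is
   [(1,1)]. *)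
Lemma cubic_point_delta h x y : cubic_point h -> x <= y ->
  h (delta y x) = if h y && h y^ then h x^ else h y.
Proof.
move=> hh xy.
have E u v : u <= v -> h v ==> h u = h (delta v u)^ || h u.
  move=> uv; rewrite -(cubic_pointU _ _ hh) -[LHS]hh /=.
  by congr h; rewrite /imp /= /cubic_imp (join_l uv).
have A u v : u <= v -> h (delta v u) || h u = h v.
  by move=> uv; rewrite -(cubic_pointU _ _ hh) deltaU.
have dy := delta_leL xy.
have xy' : x^ <= y^ by rewrite hat_le.
have dy' := delta_leL xy'.
move: (A _ _ xy) (A _ _ xy') (E _ _ xy) (E _ _ xy') (E _ _ dy) (E _ _ dy').
rewrite !deltaK // -hat_delta // hatK.
move: (cubic_cover x hh) (cubic_cover (delta y x) hh).
by case: (h x); case: (h x^); case: (h y); case: (h y^);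
   case: (h (delta y x)); case: (h (delta y x)^).
Qed.

Lemma cubic_point_hat_delta h x y : cubic_point h -> x <= y ->
  h (delta y x)^ = if h y && h y^ then h x else h y^.
Proof.
move=> hh xy; rewrite hat_delta // cubic_point_delta ?hat_le // !hatK.
by rewrite andbC.
Qed.

Lemma cubic_point_imp h x y : cubic_point h ->
  h (cubic_imp (@delta d L) x y) = h x ==> h y.
Proof. by move=> hh; exact: hh. Qed.

Lemma cubic_point_hat_imp h x y : cubic_point h ->
  h (cubic_imp (@delta d L) x y)^ = h x^ ==> h y^.
Proof.
move=> hh; rewrite /cubic_imp hatU cubic_pointU // hatK.
rewrite (cubic_point_delta hh (leUr y x)) hatU !cubic_pointU //.
move: (cubic_cover x hh) (cubic_cover y hh).
by case: (h x); case: (h y); case: (h x^); case: (h y^).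
Qed.

Definition support h x := h x && h x^.

Definition sim x y : bool := delta (x `|` y) x == y.

Lemma simP x y :
  reflect (forall h, cubic_point h -> support h x = support h y) (sim x y).
Proof.
apply: (iffP eqP) => [E h hh|S].
  have /cubic_eqP/(_ _ hh) := E.
  have /(congr1 (delta \top))/cubic_eqP/(_ _ hh) := E.
  rewrite (cubic_point_hat_delta hh (leUl x y)) (cubic_point_delta hh (leUl x y)).
  rewrite hatU !cubic_pointU // /support.
  move: (cubic_cover x hh) (cubic_cover y hh).
  by case: (h x); case: (h y); case: (h x^); case: (h y^).
apply/cubic_eqP => h hh; move: (S _ hh).
rewrite (cubic_point_delta hh (leUl x y)).
rewrite hatU !cubic_pointU // /support.
move: (cubic_cover x hh) (cubic_cover y hh).
by case: (h x); case: (h y); case: (h x^); case: (h y^).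
Qed.

Lemma sim_refl : reflexive sim.
Proof. by move=> x; apply/simP. Qed.

Lemma sim_sym : symmetric sim.
Proof. by move=> x y; apply/simP/simP => S h hh; rewrite S. Qed.

Lemma sim_trans : transitive sim.
Proof. by move=> y x z /simP xy /simP yz; apply/simP => h hh; rewrite xy ?yz. Qed.

Canonical sim_equiv_rel := EquivRel sim sim_refl sim_sym sim_trans.

End CubicPoints.

Definition scrC d (L : cubicImplicationAlgebraType d) :=
  {eq_quot (@sim_equiv_rel d L)}.

Section FunctorC.
Context d (L : cubicImplicationAlgebraType d).
Implicit Types (x y z : L) (A B C : scrC L).

HB.instance Definition _ := Choice.on (scrC L).
HB.instance Definition _ := EqQuotient.on (scrC L).

Local Notation "x ^" := (delta \top x) (at level 2, format "x ^").

(* Stated on chosen representatives; [scrC_leE], [scrC_joinE] and [scrC_impE]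
   show that any representatives give the same result. *)
Definition scrC_le A B :=
  delta (repr A `|` repr B) (repr A) <= repr B.
Definition scrC_join A B : scrC L :=
  \pi_(scrC L) (repr A `|` delta (repr A `|` repr B) (repr B)).
Definition scrC_imp A B : scrC L :=
  \pi_(scrC L) (cubic_imp (@delta d L)
         (repr B `|` delta (repr A `|` repr B) (repr A)) (repr B)).

Definition scrC_support (h : L -> bool) A := support h (repr A).

Lemma scrC_supportE h x : cubic_point h ->
  scrC_support h (\pi_(scrC L) x) = support h x.
Proof.
move=> hh; have /eqmodP/simP/(_ h hh) : repr (\pi_(scrC L) x) = x %[mod scrC L].
  by rewrite reprK.
by [].
Qed.

Lemma scrC_eqP A B :
  (forall h, cubic_point h -> scrC_support h A = scrC_support h B) <-> A = B.
Proof.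
split=> [S|->//]; rewrite -[A]reprK -[B]reprK.
by apply/eqmodP/simP.
Qed.

Lemma delta_leP x y : delta (x `|` y) x <= y <->
  forall h, cubic_point h -> support h x -> support h y.
Proof.
split=> [E h hh|S].
  have /cubic_leP/(_ _ hh)/implyP := E.
  have := E; rewrite -hat_le => /cubic_leP/(_ _ hh)/implyP.
  rewrite (cubic_point_hat_delta hh (leUl x y)) (cubic_point_delta hh (leUl x y)).
  rewrite hatU !cubic_pointU // /support.
  move: (cubic_cover x hh) (cubic_cover y hh).
  by case: (h x); case: (h y); case: (h x^); case: (h y^).
apply/cubic_leP => h hh; apply/implyP; move: (S _ hh) => /implyP.
rewrite (cubic_point_delta hh (leUl x y)).
rewrite hatU !cubic_pointU // /support.
move: (cubic_cover x hh) (cubic_cover y hh).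
by case: (h x); case: (h y); case: (h x^); case: (h y^).
Qed.

Lemma support_join h x y : cubic_point h ->
  support h (x `|` delta (x `|` y) y) = support h x || support h y.
Proof.
move=> hh; rewrite /support hatU !cubic_pointU //.
rewrite (cubic_point_hat_delta hh (leUr y x)) (cubic_point_delta hh (leUr y x)).
rewrite hatU !cubic_pointU // /support.
move: (cubic_cover x hh) (cubic_cover y hh).
by case: (h x); case: (h y); case: (h x^); case: (h y^).
Qed.

Lemma support_imp h x y : cubic_point h ->
  support h (cubic_imp (@delta d L) (y `|` delta (x `|` y) x) y) =
  support h x ==> support h y.
Proof.
move=> hh; rewrite /support cubic_point_imp // cubic_point_hat_imp //.
rewrite hatU !cubic_pointU //.
rewrite (cubic_point_hat_delta hh (leUl x y)) (cubic_point_delta hh (leUl x y)).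
rewrite hatU !cubic_pointU // /support.
move: (cubic_cover x hh) (cubic_cover y hh).
by case: (h x); case: (h y); case: (h x^); case: (h y^).
Qed.

Lemma scrC_leP A B : scrC_le A B <->
  forall h, cubic_point h -> scrC_support h A -> scrC_support h B.
Proof. exact: delta_leP. Qed.

Fact scrC_le_refl : reflexive scrC_le.
Proof. by move=> A; apply/scrC_leP. Qed.

Fact scrC_le_anti : antisymmetric scrC_le.
Proof.
move=> A B /andP[/scrC_leP AB /scrC_leP BA]; apply/scrC_eqP => h hh.
by apply/idP/idP; [exact: AB | exact: BA].
Qed.

Fact scrC_le_trans : transitive scrC_le.
Proof.
move=> B A C /scrC_leP AB /scrC_leP BC; apply/scrC_leP => h hh SA.
exact/BC/AB.
Qed.

HB.instance Definition _ := Order.Le_isPOrder.Build d (scrC L)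
  scrC_le_refl scrC_le_anti scrC_le_trans.

Fact scrC_lex1 A : A <= \pi_(scrC L) \top.
Proof.
apply/scrC_leP => h hh _; rewrite scrC_supportE // /support deltaxx.
by rewrite cubic_point1.
Qed.

HB.instance Definition _ := Order.hasTop.Build d (scrC L) scrC_lex1.

Fact scrC_leUx A B C : (scrC_join A B <= C) = (A <= C) && (B <= C).
Proof.
apply/idP/andP => [/scrC_leP S|[/scrC_leP AC /scrC_leP BC]].
  split; apply/scrC_leP => h hh SA; apply: S => //;
    rewrite scrC_supportE // support_join //; apply/orP.
  - by left.
  - by right.
apply/scrC_leP => h hh; rewrite scrC_supportE // support_join //.
by case/orP; [exact: AC | exact: BC].
Qed.

HB.instance Definition _ :=
  Order.POrder_isJoinSemilattice.Build d (scrC L) scrC_leUx.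

Lemma scrC_support_imp h A B : cubic_point h ->
  scrC_support h (scrC_imp A B) = scrC_support h A ==> scrC_support h B.
Proof. by move=> hh; rewrite scrC_supportE // support_imp. Qed.

Fact scrC_impK A B : scrC_imp (scrC_imp A B) A = A.
Proof.
apply/scrC_eqP => h hh; rewrite !scrC_support_imp //.
by case: scrC_support; case: scrC_support.
Qed.

Fact scrC_impC A B :
  scrC_imp (scrC_imp A B) B = scrC_imp (scrC_imp B A) A.
Proof.
apply/scrC_eqP => h hh; rewrite !scrC_support_imp //.
by case: (scrC_support h A); case: (scrC_support h B).
Qed.

Fact scrC_impCA A B C :
  scrC_imp A (scrC_imp B C) = scrC_imp B (scrC_imp A C).
Proof.
apply/scrC_eqP => h hh; rewrite !scrC_support_imp //.
by case: (scrC_support h A); case: (scrC_support h B).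
Qed.

Fact scrC_le_imp A B : (A <= B) = (scrC_imp A B == \top).
Proof.
have S1 h : cubic_point h -> scrC_support h \top.
  by move=> hh; have /scrC_leP/(_ h hh) := scrC_lex1 \top; rewrite scrC_supportE
   // /support deltaxx cubic_point1 // => ->.
apply/idP/eqP => [/scrC_leP AB|E].
  apply/scrC_eqP => h hh; rewrite scrC_support_imp // S1 //.
  by apply/implyP; exact: AB.
apply/scrC_leP => h hh; apply/implyP.
by rewrite -scrC_support_imp // E S1.
Qed.

HB.instance Definition _ := isImplicationAlgebra.Build d (scrC L)
  scrC_impK scrC_impC scrC_impCA scrC_le_imp.

Lemma scrC_leE x y :
  (\pi_(scrC L) x <= \pi_(scrC L) y) = (delta (x `|` y) x <= y).
Proof.
apply/idP/idP => [/scrC_leP S|/delta_leP S].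
  by apply/delta_leP => h hh; rewrite -!scrC_supportE //; exact: S.
by apply/scrC_leP => h hh; rewrite !scrC_supportE //; exact: S.
Qed.

Lemma scrC_topE : \top = \pi_(scrC L) \top. Proof. by []. Qed.

Lemma scrC_joinE x y :
  \pi_(scrC L) x `|` \pi_(scrC L) y = \pi_(scrC L) (x `|` delta (x `|` y) y).
Proof.
apply/scrC_eqP => h hh; rewrite !scrC_supportE // !support_join //.
by congr orb; exact: scrC_supportE.
Qed.

Lemma scrC_impE x y : imp (\pi_(scrC L) x) (\pi_(scrC L) y) =
  \pi_(scrC L) (cubic_imp (@delta d L) (y `|` delta (x `|` y) x) y).
Proof.
apply/scrC_eqP => h hh; rewrite !scrC_supportE // !support_imp //.
by congr implb; exact: scrC_supportE.
Qed.

End FunctorC.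

Section ConstructionI.
Context d (I : implicationAlgebraType d).

Definition scrI_pred : pred (I * I) :=
  fun p => (p.1 `|` p.2 == \top) && `[< meet_exists p.1 p.2 >].

Definition scrI := {p : I * I | scrI_pred p}.

HB.instance Definition _ := SubChoice.on scrI.

Implicit Types (p q r : scrI) (h : I -> bool).

Lemma scrI_val_inj p q :
  (forall h, point h ->
     h (val p).1 = h (val q).1 /\ h (val p).2 = h (val q).2) -> p = q.
Proof.
move=> E; apply: val_inj; rewrite [val p]surjective_pairing.
rewrite [val q]surjective_pairing; congr pair; apply/eqP_point => h hh;
  by have [] := E h hh.
Qed.

Lemma scrI_cover h p : point h -> h (val p).1 || h (val p).2.
Proof.
move=> hh; rewrite -pointU //; have /andP[/eqP-> _] := valP p.
exact: point1.
Qed.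

Lemma scrI_meet p : meet_exists (val p).1 (val p).2.
Proof. by have /andP[_ /asboolP] := valP p. Qed.

Definition scrI_le p q :=
  ((val p).1 <= (val q).1) && ((val p).2 <= (val q).2).

Fact scrI_top_subproof : scrI_pred (\top, \top).
Proof.
by rewrite /scrI_pred joinxx eqxx; apply/asboolP; exists \top; split.
Qed.

Definition scrI_top : scrI := Sub (\top, \top) scrI_top_subproof.

Fact scrI_join_subproof p q :
  scrI_pred ((val p).1 `|` (val q).1, (val p).2 `|` (val q).2).
Proof.
apply/andP; split => /=.
  apply/eqP/eqP_point => h hh; rewrite !pointU // point1 //.
  by rewrite orbACA (scrI_cover _ hh).
apply/asboolP; have [m [m1 m2 _]] := scrI_meet p.
by apply: (@lower_bound_exists _ _ _ _ m); rewrite lexU2 ?m1 ?m2.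
Qed.

Definition scrI_join p q : scrI := Sub _ (scrI_join_subproof p q).

(* On pairs with [p <= q] this is the displayed pair, see [val_scrI_delta]. *)
Definition scrI_delta q p : scrI :=
  insubd q (meet_or_top (val q).1 (imp (val q).2 (val p).2),
            meet_or_top (val q).2 (imp (val q).1 (val p).1)).

Fact scrI_le_refl : reflexive scrI_le.
Proof. by move=> p; rewrite /scrI_le !lexx. Qed.

Fact scrI_le_anti : antisymmetric scrI_le.
Proof.
move=> p q /andP[/andP[a b] /andP[a' b']]; apply: val_inj.
rewrite [val p]surjective_pairing [val q]surjective_pairing.
by congr pair; apply/le_anti/andP.
Qed.

Fact scrI_le_trans : transitive scrI_le.
Proof.
move=> q p r /andP[a b] /andP[a' b'].
by rewrite /scrI_le (le_trans a a') (le_trans b b').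
Qed.

HB.instance Definition _ := Order.Le_isPOrder.Build d scrI
  scrI_le_refl scrI_le_anti scrI_le_trans.

Fact scrI_lex1 p : p <= scrI_top.
Proof. by apply/andP; rewrite !lex1. Qed.

HB.instance Definition _ := Order.hasTop.Build d scrI scrI_lex1.

Fact scrI_leUx p q r : (scrI_join p q <= r) = (p <= r) && (q <= r).
Proof. by rewrite /Order.le /= /scrI_le /= !leUx andbACA. Qed.

HB.instance Definition _ :=
  Order.POrder_isJoinSemilattice.Build d scrI scrI_leUx.

Lemma scrI_leE p q :
  (p <= q) = ((val p).1 <= (val q).1) && ((val p).2 <= (val q).2).
Proof. by []. Qed.

Lemma scrI_leP p q : p <= q <-> forall h, point h ->
  (h (val p).1 ==> h (val q).1) && (h (val p).2 ==> h (val q).2).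
Proof.
rewrite scrI_leE; split=> [/andP[/leP_point a /leP_point b] h hh|E].
  by apply/andP; split; apply/implyP; [exact: a | exact: b].
by apply/andP; split; apply/leP_point => h /E /andP[/implyP a /implyP b].
Qed.

Lemma scrI_delta_meet p q : p <= q ->
  meet_exists (val q).1 (imp (val q).2 (val p).2) /\
  meet_exists (val q).2 (imp (val q).1 (val p).1).
Proof.
move=> /andP[a b]; have [m [m1 m2 _]] := scrI_meet p.
have ge_imp (x y : I) : x <= imp y x.
  by apply/leP_point => h hh; rewrite hh => ->; rewrite implybT.
split; apply: (@lower_bound_exists _ _ _ _ m).
- exact: le_trans m1 a.
- exact: le_trans m2 (ge_imp _ _).
- exact: le_trans m2 b.
- exact: le_trans m1 (ge_imp _ _).
Qed.

Lemma val_scrI_delta p q : p <= q ->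
  val (scrI_delta q p) =
  (meet_or_top (val q).1 (imp (val q).2 (val p).2),
   meet_or_top (val q).2 (imp (val q).1 (val p).1)).
Proof.
move=> pq; have [M1 M2] := scrI_delta_meet pq.
rewrite val_insubd ifT //; apply/andP; split => /=.
  apply/eqP/eqP_point => h hh; rewrite pointU // !pointI // !hh point1 //.
  have /scrI_leP/(_ h hh) := pq; move: (scrI_cover p hh) (scrI_cover q hh).
  by case: (h _); case: (h _); case: (h _); case: (h _).
apply/asboolP; have [_ _ H1] := meet_or_topP M1; have [_ _ H2] := meet_or_topP M2.
have /andP[a b] := pq; have [m [m1 m2 _]] := scrI_meet p.
have ge_imp (x y : I) : x <= imp y x.
  by apply/leP_point => h hh; rewrite hh => ->; rewrite implybT.
apply: (@lower_bound_exists _ _ _ _ m).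
- by apply: H1; [exact: le_trans m1 a | exact: le_trans m2 (ge_imp _ _)].
- by apply: H2; [exact: le_trans m2 b | exact: le_trans m1 (ge_imp _ _)].
Qed.

Lemma point_scrI_delta h p q : point h -> p <= q ->
  h (val (scrI_delta q p)).1 = h (val q).1 && (h (val q).2 ==> h (val p).2) /\
  h (val (scrI_delta q p)).2 = h (val q).2 && (h (val q).1 ==> h (val p).1).
Proof.
move=> hh pq; have [M1 M2] := scrI_delta_meet pq.
by rewrite val_scrI_delta //= !pointI // !hh.
Qed.

Lemma scrI_delta_leL p q : p <= q -> scrI_delta q p <= q.
Proof.
move=> pq; apply/scrI_leP => h hh; have [-> ->] := point_scrI_delta hh pq.
by case: (h _); case: (h _); case: (h _); case: (h _).
Qed.

Fact scrI_deltaU p q : p <= q -> scrI_delta q p `|` p = q.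
Proof.
move=> pq; apply: scrI_val_inj => h hh /=; rewrite !pointU //.
have [-> ->] := point_scrI_delta hh pq.
have /scrI_leP/(_ h hh) := pq; move: (scrI_cover p hh) (scrI_cover q hh).
by case: (h (val p).1); case: (h (val p).2); case: (h (val q).1);
   case: (h (val q).2).
Qed.

Fact scrI_delta_le p q r : p <= q -> q <= r ->
  scrI_delta r p <= scrI_delta r q.
Proof.
move=> pq qr; apply/scrI_leP => h hh.
have [-> ->] := point_scrI_delta hh (le_trans pq qr).
have [-> ->] := point_scrI_delta hh qr.
have /scrI_leP/(_ h hh) := pq; have /scrI_leP/(_ h hh) := qr.
by case: (h (val p).1); case: (h (val p).2); case: (h (val q).1);
   case: (h (val q).2); case: (h (val r).1); case: (h (val r).2).
Qed.

Fact scrI_delta_delta p q r : p <= q -> q <= r ->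
  scrI_delta r (scrI_delta q p) =
  scrI_delta (scrI_delta r q) (scrI_delta r p).
Proof.
move=> pq qr; apply: scrI_val_inj => h hh.
have [-> ->] := point_scrI_delta hh (le_trans (scrI_delta_leL pq) qr).
have [-> ->] := point_scrI_delta hh (scrI_delta_le pq qr).
have [-> ->] := point_scrI_delta hh pq.
have [-> ->] := point_scrI_delta hh qr.
have [-> ->] := point_scrI_delta hh (le_trans pq qr).
have /scrI_leP/(_ h hh) := pq; have /scrI_leP/(_ h hh) := qr.
move: (scrI_cover p hh).
by case: (h (val p).1); case: (h (val p).2); case: (h (val q).1);
   case: (h (val q).2); case: (h (val r).1); case: (h (val r).2).
Qed.

Fact scrI_deltaK p q : p <= q -> scrI_delta q (scrI_delta q p) = p.
Proof.
move=> pq; apply: scrI_val_inj => h hh.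
have [-> ->] := point_scrI_delta hh (scrI_delta_leL pq).
have [-> ->] := point_scrI_delta hh pq.
have /scrI_leP/(_ h hh) := pq; move: (scrI_cover p hh).
by case: (h (val p).1); case: (h (val p).2); case: (h (val q).1);
   case: (h (val q).2).
Qed.

Lemma val_scrI_imp p q : val (cubic_imp scrI_delta p q) =
  (imp (val p).1 (val q).1, imp (val p).2 (val q).2).
Proof.
rewrite [LHS]surjective_pairing.
suff H h : point h ->
    h (val (cubic_imp scrI_delta p q)).1 = (h (val p).1 ==> h (val q).1) /\
    h (val (cubic_imp scrI_delta p q)).2 = (h (val p).2 ==> h (val q).2).
  by congr pair; apply/eqP_point => h hh; rewrite hh; have [] := H h hh.
move=> hh; rewrite /cubic_imp /= !pointU //.
have [-> ->] := point_scrI_delta hh (lex1 (scrI_delta (p `|` q) q)).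
have [-> ->] := point_scrI_delta hh (leUr q p).
rewrite /= !pointU // !point1 //=.
move: (scrI_cover p hh) (scrI_cover q hh).
by case: (h (val p).1); case: (h (val p).2); case: (h (val q).1);
   case: (h (val q).2).
Qed.

Fact scrI_impU p q :
  cubic_imp scrI_delta (cubic_imp scrI_delta p q) q = p `|` q.
Proof.
by apply: val_inj; rewrite !val_scrI_imp /= -!joinEimp.
Qed.

Fact scrI_impCA p q r :
  cubic_imp scrI_delta p (cubic_imp scrI_delta q r) =
  cubic_imp scrI_delta q (cubic_imp scrI_delta p r).
Proof.
by apply: val_inj; rewrite !val_scrI_imp /= impCA (impCA (val p).2).
Qed.

HB.instance Definition _ := isCubicImplicationAlgebra.Build d scrI
  scrI_deltaU scrI_delta_delta scrI_deltaK scrI_delta_le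
  scrI_impU scrI_impCA.

Lemma scrI_mr : (forall a b : I, meet_exists a b) ->
  forall a b x : scrI, a < x -> b < x ->
    (delta x a `|` b < x) <-> ~ meet_exists a b.
Proof.
move=> lat a b x /ltW ax /ltW bx.
have D h (hh : point h) := point_scrI_delta hh ax.
have dbx : delta x a `|` b <= x by rewrite leUx bx scrI_delta_leL.
rewrite lt_neqAle dbx andbT; split.
  move=> /eqP neq [m [/scrI_leP ma /scrI_leP mb _]]; apply: neq.
  apply: scrI_val_inj => h hh /=; rewrite !pointU //.
  rewrite /delta /=; have [-> ->] := D _ hh.
  have /scrI_leP/(_ h hh) := ax; have /scrI_leP/(_ h hh) := bx.
  move: (ma _ hh) (mb _ hh) (scrI_cover m hh).
  move: (scrI_cover a hh) (scrI_cover b hh).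
  by case: (h (val a).1); case: (h (val a).2); case: (h (val b).1);
     case: (h (val b).2); case: (h (val x).1); case: (h (val x).2);
     case: (h (val m).1); case: (h (val m).2).
move=> nab; apply/eqP => E; apply: nab.
have mP : scrI_pred (meet_or_top (val a).1 (val b).1,
                     meet_or_top (val a).2 (val b).2).
  apply/andP; split => /=; last exact/asboolP/lat.
  apply/eqP/eqP_point => h hh; rewrite pointU // !pointI ?point1 //.
  have : h (val (delta x a `|` b)).1 = h (val x).1 /\
         h (val (delta x a `|` b)).2 = h (val x).2 by rewrite E.
  rewrite /= !pointU // /delta /=; have [-> ->] := D _ hh.
  have /scrI_leP/(_ h hh) := ax; have /scrI_leP/(_ h hh) := bx.
  move: (scrI_cover a hh) (scrI_cover b hh).
  by case: (h (val a).1); case: (h (val a).2); case: (h (val b).1);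
     case: (h (val b).2); case: (h (val x).1); case: (h (val x).2) => //= _ _ _ _ [].
have [a1 b1 H1] := meet_or_topP (lat (val a).1 (val b).1).
have [a2 b2 H2] := meet_or_topP (lat (val a).2 (val b).2).
exists (Sub _ mP : scrI); split.
- by rewrite scrI_leE /= a1 a2.
- by rewrite scrI_leE /= b1 b2.
- move=> c /andP[ca1 ca2] /andP[cb1 cb2].
  by rewrite scrI_leE /= H1 ?H2.
Qed.

End ConstructionI.

Lemma scrC_meet_exists d (M : mrAlgebraType d) (A B : scrC M) :
  meet_exists A B.
Proof.
rewrite -[A]reprK -[B]reprK; set x := repr A; set y := repr B.
set j := x `|` y.
have mono (u v : M) : u <= v -> \pi_(scrC M) u <= \pi_(scrC M) v.
  by move=> uv; rewrite scrC_leE (join_r uv) (le_trans (delta_leL uv)).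
have xj : x <= j := leUl x y.
have [ltx|] := boolP (x < j); last first.
  rewrite lt_neqAle xj andbT negbK => /eqP E.
  apply: (@lower_bound_exists _ _ _ _ (\pi_(scrC M) y)) => //.
  by apply: mono; rewrite E leUr.
have [lty|] := boolP (y < j); last first.
  rewrite lt_neqAle leUr andbT negbK => /eqP E.
  apply: (@lower_bound_exists _ _ _ _ (\pi_(scrC M) x)) => //.
  by apply: mono; rewrite E leUl.
have ltdx : delta j x < j.
  rewrite lt_neqAle delta_leL // andbT; apply/eqP => E.
  by move: ltx; rewrite -(deltaK xj) E deltaxx ltxx.
have [] := mr_axiom ltdx lty.
rewrite deltaK // ltxx => _ /contra_notP/(_ notF)[m [mx my _]].
apply: (@lower_bound_exists _ _ _ _ (\pi_(scrC M) m)); last exact: mono.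
have -> : \pi_(scrC M) x = \pi_(scrC M) (delta j x).
  by apply/eqmodP; rewrite /= /sim joinC deltaU.
exact: mono.
Qed.

HB.instance Definition _ d (M : mrAlgebraType d) :=
  CubicImplicationAlgebra_isMR.Build d (scrI (scrC M))
    (scrI_mr (@scrC_meet_exists d M)).

Definition cubic_hom d d' (L : cubicImplicationAlgebraType d)
    (L' : cubicImplicationAlgebraType d') (f : L -> L') : Prop :=
  [/\ {morph f : x y / x `|` y},
      f \top = \top
    & forall x y, x <= y -> f (delta y x) = delta (f y) (f x)].

(* Independent of the representative when [f] is a homomorphism: [scrC_mapE]. *)
Definition scrC_map d d' (L : cubicImplicationAlgebraType d)
    (L' : cubicImplicationAlgebraType d') (f : L -> L') (A : scrC L) :
    scrC L' :=
  \pi_(scrC L') (f (repr A)).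

Lemma scrC_mapE d d' (L : cubicImplicationAlgebraType d)
    (L' : cubicImplicationAlgebraType d') (f : L -> L') (x : L) :
  cubic_hom f -> scrC_map f (\pi_(scrC L) x) = \pi_(scrC L') (f x).
Proof.
move=> [fU _ fD]; rewrite /scrC_map; apply/eqmodP => /=.
have /eqmodP/eqP /= E : repr (\pi_(scrC L) x) = x %[mod scrC L].
  by rewrite reprK.
by rewrite /sim -fU -fD ?leUl // E.
Qed.

Section Automorphisms.
Context d (L : cubicImplicationAlgebraType d).

Definition is_cubic_aut : pred (L -> L) :=
  fun f => `[< cubic_hom f /\ bijective f >].

Definition cubicAut := {f : L -> L | is_cubic_aut f}.

HB.instance Definition _ := SubChoice.on cubicAut.

Implicit Types f g : cubicAut.

Lemma cubicAut_hom f : cubic_hom (val f).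
Proof. by have /asboolP[] := valP f. Qed.

Lemma cubicAut_bij f : bijective (val f).
Proof. by have /asboolP[] := valP f. Qed.

Fact cubicAut_one_subproof : is_cubic_aut id.
Proof. by apply/asboolP; split; [split | exists id]. Qed.

Definition cubicAut_one : cubicAut := Sub id cubicAut_one_subproof.

Fact cubicAut_mul_subproof f g : is_cubic_aut (val f \o val g).
Proof.
have [fU f1 fD] := cubicAut_hom f; have [gU g1 gD] := cubicAut_hom g.
apply/asboolP; split; last exact: bij_comp (cubicAut_bij f) (cubicAut_bij g).
split=> [x y|//|x y xy] /=; first by rewrite gU fU.
  by rewrite g1 f1.
by rewrite gD // fD // leEjoin -gU (join_r xy).
Qed.

Definition cubicAut_mul f g : cubicAut := Sub _ (cubicAut_mul_subproof f g).

Fact cubicAut_inverse f : exists g : L -> L, cancel (val f) g /\ cancel g (val f).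
Proof. by have [g fK gK] := cubicAut_bij f; exists g. Qed.

Definition cubicAut_inv_fun f : L -> L := projT1 (cid (cubicAut_inverse f)).

Lemma cubicAut_invK f : cancel (cubicAut_inv_fun f) (val f).
Proof. by rewrite /cubicAut_inv_fun; case: cid => g []. Qed.

Lemma cubicAutK f : cancel (val f) (cubicAut_inv_fun f).
Proof. by rewrite /cubicAut_inv_fun; case: cid => g []. Qed.

Fact cubicAut_inv_subproof f : is_cubic_aut (cubicAut_inv_fun f).
Proof.
have fI := bij_inj (cubicAut_bij f); have [fU f1 fD] := cubicAut_hom f.
have gU : {morph cubicAut_inv_fun f : x y / x `|` y}.
  by move=> x y; apply: fI; rewrite fU !cubicAut_invK.
apply/asboolP; split.
  split=> [//||x y xy]; first by rewrite -{1}f1 cubicAutK.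
  apply: fI; rewrite fD; first by rewrite !cubicAut_invK.
  by rewrite leEjoin -gU (join_r xy).
by exists (val f); [exact: cubicAut_invK | exact: cubicAutK].
Qed.

Definition cubicAut_inv f : cubicAut := Sub _ (cubicAut_inv_subproof f).

Fact cubicAut_mulA : associative cubicAut_mul.
Proof. by move=> f g h; apply: val_inj. Qed.

Fact cubicAut_mul1g : left_id cubicAut_one cubicAut_mul.
Proof. by move=> f; apply: val_inj. Qed.

Fact cubicAut_mulg1 : right_id cubicAut_one cubicAut_mul.
Proof. by move=> f; apply: val_inj. Qed.

Fact cubicAut_mulVg : left_inverse cubicAut_one cubicAut_inv cubicAut_mul.
Proof. by move=> f; apply/val_inj/funext => x /=; rewrite cubicAutK. Qed.

Fact cubicAut_mulgV : right_inverse cubicAut_one cubicAut_inv cubicAut_mul.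
Proof. by move=> f; apply/val_inj/funext => x /=; rewrite cubicAut_invK. Qed.

HB.instance Definition _ := isGroup.Build cubicAut
  cubicAut_mulA cubicAut_mul1g cubicAut_mulg1 cubicAut_mulVg cubicAut_mulgV.

End Automorphisms.

Section Inner.
Context d (M : mrAlgebraType d).
Implicit Types f g : cubicAut M.

(* The kernel of [Aut M -> Aut (C M)]; [is_innerP] restates it as [f x ~ x]. *)
Definition is_inner : pred (cubicAut M) :=
  fun f => `[< scrC_map (val f) = id >].

Lemma is_innerP f : reflect (forall x : M, sim (val f x) x) (is_inner f).
Proof.
have fH := cubicAut_hom f.
apply: (iffP (asboolP _)) => [E x|S].
  by apply/eqmodP; rewrite -scrC_mapE // E.
by apply/funext => A; rewrite -[A]reprK scrC_mapE //; apply/eqmodP/S.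
Qed.

Fact is_inner_group_closed : group_closed is_inner.
Proof.
split; first by apply/is_innerP => x; exact: sim_refl.
move=> f g /is_innerP fS /is_innerP gS; apply/is_innerP => x.
have /= := gS (val g^-1%g x); rewrite cubicAut_invK => gS'.
apply: (sim_trans (fS _)); rewrite sim_sym; exact: gS'.
Qed.

Definition Inn := {f : cubicAut M | is_inner f}.

HB.instance Definition _ := SubChoice.on Inn.
HB.instance Definition _ :=
  SubChoice_isSubGroup.Build (cubicAut M) is_inner Inn is_inner_group_closed.

End Inner.

(* Main.v *)
Require Import Defs.
From HB Require Import structures.
From mathcomp Require Import all_boot all_order.
From mathcomp Require Import boolp classical_sets.

(** An inner automorphism [f] keeps the support of every element, so in the
    picture where a point [h] reads [x] as a sign [(h x, h x^)], all that [f]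
    can do to [x] is to exchange the two signs [(1,0)] and [(0,1)] at some of
    the points outside the support of [x].  The points where it does so are the
    ones that [x `|` f x] adds to the support of [x], so the class
    [D [x] := [x `|` f x]] records the whole effect of [f] on [x].  Monotonicity
    of [f] forces the region of exchange to shrink to its part outside the
    support of [y] when [x] grows to [y], and an application of [delta] leaves it unchanged; this says
    that [D] is a well defined map on [C M] with [D (A `|` B) = D A `|` B]
    ([flip_multiplier]).  Call such a map a multiplier.

    The assignment of [D] to [f] is injective ([flip_inj]), and it turns
    composition into the pointwise symmetric difference in the Boolean interval
    [[A, 1]] ([flipM]).  It is onto ([flip_surj]): a multiplier [D] gives
    [x |-> delta y x] where [y >= x] has class [D [x]].  That this preserves
    joins is where the MR axiom enters: any two classes have a
    common lower bound [C], and [D C] dictates the exchange on both elements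
    simultaneously, so the two cannot be treated inconsistently.

    Hence [Inn M] is determined, with its multiplication, by the implication
    algebra [C M].  The same analysis applies to [I (C M)], whose supports are
    again the elements of [C M] through [(a, b) |-> a /\ b], and the theorem
    follows by matching inner automorphisms that have the same multiplier.  To
    treat both algebras at once, the class map is replaced by any map [s] to an
    implication algebra that encodes supports faithfully ([support_map]). *)

Set Implicit Arguments.
Unset Strict Implicit.
Unset Printing Implicit Defensive.

Import Order.TTheory.
Import Defs.

Local Open Scope order_scope.
Local Open Scope quotient_scope.

Local Notation "x ^" := (delta \top x) (at level 2, format "x ^").

(** * Maps that encode supports *)

(** [imp a b] is the least element above [b] that joins with [a] to the top.
    This describes [imp] by the order alone, so that maps that respect the order
    of supports respect [imp] too. *)
Lemma imp_leE d (I : implicationAlgebraType d) (a b c : I) :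
  (imp a b <= c) = (b <= c) && (a `|` c == \top).
Proof.
apply/idP/andP => [/leP_point bc|[/leP_point bc /eqP ac]].
  split; first by apply/leP_point => h hh hb; apply: bc; rewrite // hh hb implybT.
  apply/eqP/eqP_point => h hh; rewrite pointU // point1 //.
  by have /implyP := bc h hh; rewrite hh; case: (h a).
apply/leP_point => h hh; have /implyP := bc h hh; rewrite hh.
have : h (a `|` c) by rewrite ac point1.
by rewrite pointU //; case: (h a); case: (h b).
Qed.

(** Such an [s] is the quotient map [L -> C L] followed by an order isomorphism
    [C L -> I]. *)
Definition support_map d (L : cubicImplicationAlgebraType d)
    d' (I : implicationAlgebraType d') (s : L -> I) : Prop :=
  (forall A, exists x, s x = A) /\
  (forall x y, s x <= s y <->
     forall h, cubic_point h -> support h x -> support h y).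

Definition lift (T : choiceType) (U : Type) (x0 : T) (s : T -> U) (A : U) : T :=
  xget x0 [set x | s x = A]%classic.

Section SupportMap.
Context d (L : cubicImplicationAlgebraType d).
Context d' (I : implicationAlgebraType d') (s : L -> I).
Hypothesis s_support : support_map s.
Implicit Types (x y z : L) (A B : I) (h : L -> bool).

Lemma liftK A : s (lift \top s A) = A.
Proof.
have [surj _] := s_support; have [x sx] := surj A.
exact: (@xgetI _ \top [set x | s x = A]%classic x sx).
Qed.

Lemma support_map_eqP x y :
  s x = s y <-> forall h, cubic_point h -> support h x = support h y.
Proof.
have [_ sle] := s_support; split=> [E h hh|E].
  have /sle/(_ h hh) xy : s x <= s y by rewrite E.
  have /sle/(_ h hh) yx : s y <= s x by rewrite E.
  exact/idP/idP.
by apply/le_anti/andP; split; apply/sle => h hh; rewrite E.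
Qed.

Lemma support_map_homo x y : x <= y -> s x <= s y.
Proof.
move=> xy; apply/(s_support.2 _ _) => h hh /andP[hx hx'].
apply/andP; split; first exact: (cubic_leP x y).2 xy h hh hx.
by apply: (cubic_leP x^ y^).2 hx'; rewrite ?hat_le.
Qed.

Lemma support_map_sim x y : sim x y -> s x = s y.
Proof. by move=> /simP xy; apply/support_map_eqP. Qed.

(** Points of [L] transported to [I]: [A] stands for a support, and [read h A]
    tells whether [h] lies in it. *)
Definition read h A := support h (lift \top s A).

Lemma readE h x : cubic_point h -> read h (s x) = support h x.
Proof. by move: h; apply/support_map_eqP; rewrite liftK. Qed.

Lemma read_leP A B :
  A <= B <-> forall h, cubic_point h -> read h A -> read h B.
Proof.
have [_ sle] := s_support.
by rewrite -[X in X <= _]liftK -[X in _ <= X]liftK; exact: sle.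
Qed.

Lemma read_eqP A B : A = B <-> forall h, cubic_point h -> read h A = read h B.
Proof.
by rewrite -[A in A = B]liftK -[B in _ = B]liftK; exact: support_map_eqP.
Qed.

Lemma support_top h : cubic_point h -> support h \top.
Proof. by move=> hh; rewrite /support deltaxx cubic_point1. Qed.

Lemma read1 h : cubic_point h -> read h \top.
Proof.
have /read_leP le1 := lex1 (s \top) => hh.
by apply: le1 => //; rewrite readE // support_top.
Qed.

(** The join in [I] is union of supports, because the union is itself the
    support of an element of [L] and [s] reflects the order. *)
Lemma readU h A B : cubic_point h -> read h (A `|` B) = read h A || read h B.
Proof.
set x := lift \top s A; set y := lift \top s B.
suff <- : s (x `|` delta (x `|` y) y) = A `|` B.
  by move=> hh; rewrite readE // support_join.
apply/le_anti/andP; split.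
  apply/read_leP => h0 hh; rewrite readE // support_join //.
  by move=> /orP[]; apply: (read_leP _ _).1; rewrite // ?leUl ?leUr.
rewrite leUx; apply/andP; split; apply/read_leP => h0 hh;
  rewrite readE // support_join // => R; apply/orP; [by left | by right].
Qed.

(** [s] carries an element of [L] with the support expected of an implication
    to the implication of the images, by the description of [imp] through the
    order. *)
Lemma read_point h : cubic_point h -> point (read h).
Proof.
move=> hh A B; set x := lift \top s A; set y := lift \top s B.
set w := cubic_imp (@delta d L) (y `|` delta (x `|` y) x) y.
have wE h0 (hh0 : cubic_point h0) : read h0 (s w) = read h0 A ==> read h0 B.
  by rewrite readE // support_imp.
suff -> : imp A B = s w by rewrite wE.
apply/le_anti/andP; split.
  rewrite imp_leE; apply/andP; split.
    by apply/read_leP => h0 hh0 hB; rewrite wE // hB implybT.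
  apply/eqP/read_eqP => h0 hh0; rewrite readU // wE // read1 //.
  by case: (read h0 A).
have : imp A B <= imp A B by [].
rewrite {1}imp_leE => /andP[/read_leP BC /eqP AC]; apply/read_leP => h0 hh0.
have : read h0 (A `|` imp A B) by rewrite AC read1.
rewrite wE // readU //; case: (read h0 A) => //= _.
exact: BC.
Qed.

End SupportMap.

(** * Supports in [L] and in the pairs of construction [I] *)

Lemma pi_support_map d (L : cubicImplicationAlgebraType d) :
  support_map (fun x : L => \pi_(scrC L) x).
Proof.
split=> [A|x y]; first by exists (repr A); rewrite reprK.
by rewrite scrC_leE; exact: delta_leP.
Qed.

Section ConstructionISupport.
Context d (I : implicationAlgebraType d).

Definition scrI_support (p : scrI I) : I :=
  meet_or_top (val p).1 (val p).2.

Lemma point_scrI_support h p : point h ->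
  h (scrI_support p) = h (val p).1 && h (val p).2.
Proof. exact/pointI/scrI_meet. Qed.

(** At a point of [I] the pair [p] has sign [(1,1)] exactly when the meet of its
    components is [1] there, and [delta (p `|` q) p <= q] can be tested on the
    points of [I]. *)
Lemma scrI_support_map : support_map scrI_support.
Proof.
split=> [A|p q].
  have pP : scrI_pred (A, \top).
    apply/andP; split; first by rewrite joinx1.
    by apply/asboolP; apply: (@lower_bound_exists _ _ _ _ A); rewrite /= ?lex1.
  exists (Sub (A, \top) pP); apply/eqP_point => h hh.
  by rewrite point_scrI_support //= point1 // andbT.
rewrite -delta_leP; split=> [/leP_point E|/scrI_leP E].
  apply/scrI_leP => h hh.
  have [-> ->] := point_scrI_delta hh (leUl p q); rewrite /= !pointU //.
  move: (E h hh); rewrite !point_scrI_support // => /implyP.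
  move: (scrI_cover p hh) (scrI_cover q hh).
  by case: (h (val p).1); case: (h (val p).2); case: (h (val q).1);
     case: (h (val q).2).
apply/leP_point => h hh; move: (E h hh).
have [-> ->] := point_scrI_delta hh (leUl p q); rewrite /= !pointU //.
rewrite !point_scrI_support //.
move: (scrI_cover p hh) (scrI_cover q hh).
by case: (h (val p).1); case: (h (val p).2); case: (h (val q).1);
   case: (h (val q).2).
Qed.

End ConstructionISupport.

(** * Inner automorphisms as multipliers *)

(** With [B := A] this gives [A <= D A]. *)
Definition multiplier d (I : joinSemilatticeType d) (D : I -> I) : Prop :=
  forall A B, D (A `|` B) = D A `|` B.

Section InnerAutomorphisms.
Context d (M : mrAlgebraType d).
Context d' (I : implicationAlgebraType d') (s : M -> I).
Hypothesis s_support : support_map s.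
Implicit Types (x y : M) (A B : I) (h : M -> bool) (f g : Inn M).

Local Notation app f := (val (val f)).

(** Above [A], this is the region in which [f] exchanges signs on the elements
    of support [A]. *)
Definition flip f A : I :=
  let x := lift \top s A in s (x `|` app f x).

Lemma inner_support f x h : cubic_point h ->
  support h (app f x) = support h x.
Proof. by move=> hh; have /is_innerP/(_ x)/simP := valP f; apply. Qed.

Lemma support_map_inner f x : s (app f x) = s x.
Proof. by apply: (support_map_sim s_support); have /is_innerP := valP f. Qed.

(** The element [delta (x `|` y) x] has the support of [x] and lies below [y].
    Outside the support of [y] it has the signs of [y], so [f] acts on both in
    the same way there, and it acts on [delta (x `|` y) x] as it does on [x].
    Since [x] and [y] are only compared by their supports, this also makes
    [flip] independent of the choice of [lift]. *)
Lemma support_join_inner f x y h :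
    (forall k, cubic_point k -> support k x -> support k y) -> cubic_point h ->
  support h (y `|` app f y) = support h (x `|` app f x) || support h y.
Proof.
move=> /delta_leP zy hh; have [fU _ fD] := cubicAut_hom (val f).
have fzy : delta (app f x `|` app f y) (app f x) <= app f y.
  by rewrite -fU -fD ?leUl // leEjoin -fU (join_r zy).
have := fzy; rewrite -hat_le => /cubic_leP/(_ h hh)/implyP.
have := zy; rewrite -hat_le => /cubic_leP/(_ h hh)/implyP.
move: zy fzy => /cubic_leP/(_ h hh)/implyP + /cubic_leP/(_ h hh)/implyP.
rewrite (cubic_point_hat_delta hh (leUl x y)) (cubic_point_delta hh (leUl x y)).
rewrite (cubic_point_hat_delta hh (leUl (app f x) (app f y))).
rewrite (cubic_point_delta hh (leUl (app f x) (app f y))).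
(* [f] preserves the places where [x] and [y] carry opposite signs. *)
move: (inner_support f (x `|` y) hh); rewrite fU.
move: (inner_support f x hh) (inner_support f y hh).
move: (cubic_cover x hh) (cubic_cover y hh).
move: (cubic_cover (app f x) hh) (cubic_cover (app f y) hh).
rewrite /support !hatU !cubic_pointU //.
by case: (h x); case: (h x^); case: (h y); case: (h y^);
   case: (h (app f x)); case: (h (app f x)^);
   case: (h (app f y)); case: (h (app f y)^).
Qed.

Lemma flipE f x : flip f (s x) = s (x `|` app f x).
Proof.
apply/(support_map_eqP s_support) => h hh.
rewrite (@support_join_inner f x) //; last first.
  by move=> h0 hh0; rewrite -[support h0 x](readE s_support).
rewrite -[support h (lift _ _ _)]/(read s h (s x)) readE //.
rewrite /support !hatU !cubic_pointU //.
by case: (h x); case: (h x^); case: (h (app f x)); case: (h (app f x)^).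
Qed.

Lemma flip_multiplier f : multiplier (flip f).
Proof.
move=> A B; set x := lift \top s A; set y := lift \top s (A `|` B).
apply/(read_eqP s_support) => h hh.
rewrite readU // !readE // (@support_join_inner f x) //; last first.
  by have /(read_leP s_support) := leUl A B; exact.
rewrite -[support h y]/(read s h (A `|` B)) readU //.
rewrite orbA -[read s h A]/(support h x); congr orb.
rewrite /support !hatU !cubic_pointU //.
by case: (h x); case: (h x^); case: (h (app f x)); case: (h (app f x)^).
Qed.

Lemma flip_inj : injective flip.
Proof.
move=> f g E; apply/val_inj/val_inj/funext => x /=.
apply/cubic_eqP => h hh.
have : flip f (s x) = flip g (s x) by rewrite E.
rewrite !flipE => /(support_map_eqP s_support)/(_ h hh).
move: (inner_support f x hh) (inner_support g x hh).
move: (cubic_cover x hh) (cubic_cover (app f x) hh) (cubic_cover (app g x) hh).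
rewrite /support !hatU !cubic_pointU //.
by case: (h x); case: (h x^); case: (h (app f x)); case: (h (app f x)^);
   case: (h (app g x)); case: (h (app g x)^).
Qed.

(** The region of exchange of [f * g] is the symmetric difference of those of
    [f] and [g]: exchanging twice does nothing.  The right-hand side is
    that symmetric difference, formed in the Boolean interval above [A]. *)
Lemma flipM f g A : flip (f * g)%g A =
  imp (imp (flip f A) (flip g A)) A `|` imp (imp (flip g A) (flip f A)) A.
Proof.
rewrite -[A](liftK s_support); set x := lift \top s A.
apply/(read_eqP s_support) => h hh; rewrite readU //.
have rI A1 B1 : read s h (imp A1 B1) = read s h A1 ==> read s h B1.
  by have := @read_point _ _ _ _ _ s_support h hh A1 B1.
(* [f] is applied to [g x], so its region has to be read off from [g x]. *)
rewrite !rI -{2 6}(support_map_inner g x) !flipE !readE //=.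
move: (inner_support g x hh) (inner_support f (app g x) hh).
move: (cubic_cover x hh) (cubic_cover (app g x) hh).
move: (cubic_cover (app f (app g x)) hh).
rewrite /support !hatU !cubic_pointU //.
by case: (h x); case: (h x^); case: (h (app g x)); case: (h (app g x)^);
   case: (h (app f (app g x))); case: (h (app f (app g x))^).
Qed.

(** Here the MR axiom enters: [C M] is a lattice. *)
Lemma support_map_lower_bound A B : exists2 C, C <= A & C <= B.
Proof.
have [_ sle] := s_support.
have le_pi x y : (\pi_(scrC M) x <= \pi_(scrC M) y) = (s x <= s y).
  rewrite scrC_leE; apply/idP/idP => [/delta_leP E|/sle E].
    exact/sle.
  exact/delta_leP.
rewrite -[A](liftK s_support) -[B](liftK s_support).
set x := lift _ _ A; set y := lift _ _ B.
have [m []] := scrC_meet_exists (\pi_(scrC M) x) (\pi_(scrC M) y).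
by rewrite -[m]reprK !le_pi => mx my _; exists (s (repr m)).
Qed.

Section OfMultiplier.
Variable D : I -> I.
Hypothesis D_mult : multiplier D.

(** The element [x `|` delta (x `|` w) w] lies above [x] and its support is the
    union of those of [x] and [w], here [D (s x)]; [delta] then exchanges the
    signs of [x] in that region. *)
Definition multiplier_fun x : M :=
  let w := lift \top s (D (s x)) in delta (x `|` delta (x `|` w) w) x.

Local Notation mf := multiplier_fun.

(** Any [C] below the support of [x] may be used instead of [s x], because
    [D (s x)] and [D C] differ only inside the support of [x], where an exchange
    of signs has no effect.  So one [C] can serve several elements. *)
Lemma point_multiplier_fun C x h : C <= s x -> cubic_point h ->
  (h (mf x) = if read s h (D C) then h x^ else h x) /\
  (h (mf x)^ = if read s h (D C) then h x else h x^).
Proof.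
move=> Cx hh; rewrite /mf; set w := lift _ _ _; set y := x `|` _.
have xy : x <= y := leUl _ _.
have yE : support h y = support h x || read s h (D C).
  rewrite support_join // -[support h w]/(read s h (D (s x))).
  by rewrite -{1}(join_r Cx) D_mult readU // readE // orbC -orbA orbb orbC.
rewrite (cubic_point_hat_delta hh xy) (cubic_point_delta hh xy).
have /cubic_leP/(_ h hh)/implyP := xy.
have := xy; rewrite -hat_le => /cubic_leP/(_ h hh)/implyP.
move: yE (cubic_cover x hh); rewrite /support.
by case: (h x); case: (h x^); case: (h y); case: (h y^); case: (read _ _ _).
Qed.

Lemma support_map_multiplier_fun x : s (mf x) = s x.
Proof.
apply/(support_map_eqP s_support) => h hh; rewrite /support.
have [-> ->] := point_multiplier_fun (lexx (s x)) hh.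
by case: ifP => // _; rewrite andbC.
Qed.

(** With a common lower bound [C] of the two supports, the map exchanges the
    signs of [x], [y] and [x `|` y] in one and the same region [D C]. *)
Lemma multiplier_funU : {morph mf : x y / x `|` y}.
Proof.
move=> x y; have [C Cx Cy] := support_map_lower_bound (s x) (s y).
have Cxy : C <= s (x `|` y).
  by apply: le_trans Cx _; apply: (support_map_homo s_support); exact: leUl.
apply/cubic_eqP => h hh; rewrite cubic_pointU //.
have [-> _] := point_multiplier_fun Cxy hh.
have [-> _] := point_multiplier_fun Cx hh.
have [-> _] := point_multiplier_fun Cy hh.
by rewrite hatU !cubic_pointU //; case: ifP.
Qed.

Lemma multiplier_funK : involutive mf.
Proof.
move=> x; apply/cubic_eqP => h hh.
have sx : s x <= s (mf x) by rewrite support_map_multiplier_fun.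
have [-> _] := point_multiplier_fun sx hh.
have [-> ->] := point_multiplier_fun (lexx (s x)) hh.
by case: (read _ _ _).
Qed.

Lemma multiplier_fun_hom : cubic_hom mf.
Proof.
split=> [||x y xy]; first exact: multiplier_funU.
  by rewrite -{1}(joinx1 (mf \top)) multiplier_funU multiplier_funK join1x.
have mxy : mf x <= mf y by rewrite leEjoin -multiplier_funU (join_r xy).
(* [x] and [delta y x] have the same support, so [s x] dictates the exchange
   on [x], on [delta y x] and on [y]. *)
have sx : s x <= s (delta y x).
  apply/(s_support.2 _ _) => h hh; rewrite /support.
  rewrite (cubic_point_hat_delta hh xy) (cubic_point_delta hh xy).
  have /cubic_leP/(_ h hh)/implyP := xy.
  have := xy; rewrite -hat_le => /cubic_leP/(_ h hh)/implyP.
  by case: (h x); case: (h x^); case: (h y); case: (h y^).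
have sy := support_map_homo s_support xy.
apply/cubic_eqP => h hh.
have [-> _] := point_multiplier_fun sx hh.
rewrite (cubic_point_delta hh mxy).
have [_ ->] := point_multiplier_fun (lexx (s x)) hh.
have [-> ->] := point_multiplier_fun sy hh.
rewrite (cubic_point_hat_delta hh xy) (cubic_point_delta hh xy).
by case: (read _ _ _); rewrite // andbC.
Qed.

Lemma multiplier_fun_aut : is_cubic_aut mf.
Proof.
apply/asboolP; split; first exact: multiplier_fun_hom.
by exists mf; exact: multiplier_funK.
Qed.

Lemma multiplier_fun_inner : is_inner (Sub mf multiplier_fun_aut : cubicAut M).
Proof.
apply/is_innerP => x; apply/simP => h hh.
by apply: (support_map_eqP s_support _ _).1 => //; exact: support_map_multiplier_fun.
Qed.

Lemma flip_surj : exists f, flip f = D.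
Proof.
exists (Sub _ multiplier_fun_inner : Inn M); apply/funext => A.
rewrite -[A](liftK s_support) flipE /=; set x := lift _ _ A.
apply/(read_eqP s_support) => h hh; rewrite readE //.
have := D_mult (s x) (s x); rewrite joinxx => /(congr1 (read s h)).
rewrite readU // readE // /support hatU !cubic_pointU //.
have [-> ->] := point_multiplier_fun (lexx (s x)) hh.
move: (cubic_cover x hh).
by case: (h x); case: (h x^); case: (read _ _ _).
Qed.

End OfMultiplier.

End InnerAutomorphisms.

Theorem theorem6p16 (d : Order.disp_t) (M : mrAlgebraType d) :
  exists phi : {multiplicative Inn M -> Inn (scrI (scrC M))}, bijective phi.
Proof.
have sM := pi_support_map M; have sN := scrI_support_map (scrC M).
have toN (f : Inn M) := cid (flip_surj sN (flip_multiplier sM f)).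
have toM (g : Inn (scrI (scrC M))) := cid (flip_surj sM (flip_multiplier sN g)).
pose phi f := projT1 (toN f).
have phiE f : flip _ (phi f) = flip _ f := projT2 (toN f).
have phiM : {morph phi : f g / (f * g)%g}.
  move=> f g; apply: (flip_inj sN); rewrite phiE; apply/funext => A.
  by rewrite (flipM sM) (flipM sN) !phiE.
pose mphi := isMultiplicative.Build _ _ phi phiM.
exists (HB.pack_for {multiplicative Inn M -> Inn (scrI (scrC M))} phi mphi).
exists (fun g => projT1 (toM g)) => [f|g] /=.
  by apply: (flip_inj sM); rewrite (projT2 (toM _)) phiE.
by apply: (flip_inj sN); rewrite phiE (projT2 (toM _)).
Qed.
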